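(* Let $s\in\mathcal{T}_{\mathsf{A}}$. i) $s\in\mathrm{int}\,\mathcal{T}_{\mathsf{A}}$ if and only if $\mathcal{W}(s)=\mathcal{X}\times\Sigma$. ii) $s$ is indeterminate if and only if the family $\{t_{\mathsf{A}}(x,\sigma)\mid(x,\sigma)\in\mathcal{W}(s)\}$ (indexed by $(x,\sigma)\in\mathcal{W}(s)$) is linearly dependent. iii) Assume that 1) $\mathcal{X}$ is a locally compact Hausdorff space, 2) for every $x\in\mathcal{X}$ and $\sigma\in\Sigma$ there is a compact neighborhood $U_{x,\sigma}\subseteq\mathrm{supp}\,\delta_{x,\sigma}$ with $\delta_{x,\sigma}(U_{x,\sigma})>0$, and 3) for every $f\in\mathrm{lin}\,\mathsf{A}$ with $f\geq0$ on $\mathcal{X}$, if $f|_U=0$ for a neighborhood $U$ then $f=0$. Then every $s\in\mathcal{T}_{\mathsf{A}}\setminus\{0\}$ is indeterminate and $\mathcal{W}(s)=\mathcal{X}\times\Sigma$ for all $s\in\mathcal{T}_{\mathsf{A}}\setminus\{0\}$.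
   Context: Setting. $\mathcal{X}$ is a topological space, $\Sigma$ is a set of parameters contained in a larger metric space, and for every $(\xi,\sigma)\in\mathcal{X}\times\Sigma$ a probability measure $\delta_{\xi,\sigma}$ on $\mathcal{X}$ is given. $\mathsf{A}=\{a_1,\dots,a_m\}$ is a set of $m$ linearly independent continuous functions $a_i:\mathcal{X}\to\mathbb{R}$ with $\left|\int_{\mathcal{X}} a_i\,\mathrm{d}\delta_{\xi,\sigma}\right|<\infty$ for all $(\xi,\sigma)\in\mathcal{X}\times\Sigma$. There is $\sigma_0\in\overline{\Sigma}$ such that $\lim_{\Sigma\ni\sigma\to\sigma_0}\int_{\mathcal{X}} a_i\,\mathrm{d}\delta_{\xi,\sigma}=a_i(\xi)$ for all $\xi\in\mathcal{X}$ and $i=1,\dots,m$. $\mathrm{lin}\,\mathsf{A}$ is the linear span of $\mathsf{A}$. Notation. $t_{\mathsf{A}}(x,\sigma):=\left(\int_{\mathcal{X}} a_i\,\mathrm{d}\delta_{x,\sigma}\right)_{i=1}^m\in\mathbb{R}^m$ and $\mathcal{T}_{\mathsf{A}}:=\{\sum_{i=1}^m c_i\,t_{\mathsf{A}}(x_i,\sigma_i)\mid c_i\geq0,(x_i,\sigma_i)\in\mathcal{X}\times\Sigma\}$; interiors are taken in $\mathbb{R}^m$. A mixture representation of $s\in\mathcal{T}_{\mathsf{A}}$ is a finite mixture $\sum_{i=1}^k c_i\,\delta_{x_i,\sigma_i}$ with $c_i>0$, $(x_i,\sigma_i)\in\mathcal{X}\times\Sigma$ (determined by the components $(x_i,\sigma_i)$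 and their weights) such that $s=\sum_{i=1}^k c_i\,t_{\mathsf{A}}(x_i,\sigma_i)$. The set of atoms is \[\mathcal{W}(s):=\left\{(x,\sigma)\in\mathcal{X}\times\Sigma\,\middle|\,\exists\,k\in\mathbb{N}_0,\ c,c_i>0,\ (x_i,\sigma_i)\in\mathcal{X}\times\Sigma:\ s=c\,t_{\mathsf{A}}(x,\sigma)+\sum_{i=1}^k c_i\,t_{\mathsf{A}}(x_i,\sigma_i)\right\}.\] $s$ is called determined if it has only one mixture representation, and indeterminate otherwise. In 2) and 3) ''neighborhood'' means a set with nonempty interior. *)

(* Defs.v *)
From HB Require Import structures.
From mathcomp Require Import all_boot all_order all_algebra.
From mathcomp Require Import all_classical all_reals all_analysis.

Set Implicit Arguments.
Unset Strict Implicit.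
Unset Printing Implicit Defensive.

Import Order.TTheory GRing.Theory Num.Theory.
Import numFieldNormedType.Exports.

Local Open Scope classical_set_scope.
Local Open Scope ring_scope.

(* X with its Borel sigma-algebra.  Measurable types are pointed in the
   library, so X is nonempty throughout. *)
Notation borel X := (g_sigma_algebraType (@open X)).

(* The family v restricted to indices in W.  It is indexed: equal vectors at
   two distinct indices make it dependent. *)
Definition linearly_independent (R : nzRingType) (V : lmodType R) (I : Type)
    (W : set I) (v : I -> V) : Prop :=
  forall (n : nat) (p : 'I_n -> I) (c : 'I_n -> R),
    injective p -> (forall i, W (p i)) ->
    \sum_(i < n) c i *: v (p i) = 0 -> forall i, c i = 0.

(* The limit of f(sigma) as sigma tends to sigma0 inside Sigma, in the usual
   sense: sigma0 has to be an accumulation point of Sigma, and the value of f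
   at sigma0 itself (should sigma0 belong to Sigma) plays no role. *)
Definition has_limit_in (T : topologicalType) (R : realType)
    (Sigma : set T) (sigma0 : T) (f : T -> R) (l : R) : Prop :=
  limit_point Sigma sigma0 /\
  f sigma @[sigma --> within Sigma sigma0^'] --> l.

Definition measure_support (X : ptopologicalType) (R : realType)
    (mu : {measure set (borel X) -> \bar R}) : set X :=
  [set x | forall U : set X, open U -> U x -> (0 < mu U)%E].

Definition lin (R : realType) (X : Type) (m : nat) (a : 'I_m -> X -> R) :
    set (X -> R) :=
  [set f | exists c : 'I_m -> R, f = fun x => \sum_(i < m) c i * a i x].

Section Mixtures.
Context (R : realType) (X : ptopologicalType) (P : metricType R) (m : nat).
(* delta is total on X * P for convenience; only its values at parameters in
   Sigma are ever used. *)
Variables (a : 'I_m -> X -> R) (delta : X -> P -> probability (borel X) R).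
Variable Sigma : set P.

Definition moment_vector (x : X) (sigma : P) : 'rV[R]_m :=
  \row_(i < m) \int[delta x sigma]_y a i y.

(* m is also the number of functions a_i; by conic Caratheodory, m summands
   give all finite conic combinations. *)
Definition moment_cone : set 'rV[R]_m :=
  [set s | exists (c : 'I_m -> R) (x : 'I_m -> X) (sigma : 'I_m -> P),
    [/\ forall i, 0 <= c i,
        forall i, Sigma (sigma i) &
        s = \sum_(i < m) c i *: moment_vector (x i) (sigma i)]].

Definition atoms (s : 'rV[R]_m) : set (X * P) :=
  [set q | Sigma q.2 /\
    exists (k : nat) (c : R) (ci : 'I_k -> R)
           (x : 'I_k -> X) (sigma : 'I_k -> P),
    [/\ 0 < c,
        forall i, 0 < ci i,
        forall i, Sigma (sigma i) &
        s = c *: moment_vector q.1 q.2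
            + \sum_(i < k) ci i *: moment_vector (x i) (sigma i)]].

(* A finite mixture is identified with its weight function on components: the
   formal sum of the c_i * delta_(x_i, sigma_i), where repeated components are
   merged and order is irrelevant, but distinct components are kept apart even
   if the corresponding measures coincide. *)
Definition mixture (k : nat) (c : 'I_k -> R) (x : 'I_k -> X)
    (sigma : 'I_k -> P) : X * P -> R :=
  fun q => \sum_(i < k | (x i, sigma i) == q) c i.

Definition mixture_representation (s : 'rV[R]_m) (w : X * P -> R) : Prop :=
  exists (k : nat) (c : 'I_k -> R) (x : 'I_k -> X) (sigma : 'I_k -> P),
    [/\ forall i, 0 < c i,
        forall i, Sigma (sigma i),
        w = mixture c x sigma &
        s = \sum_(i < k) c i *: moment_vector (x i) (sigma i)].

Definition determined (s : 'rV[R]_m) : Prop :=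
  exists! w : X * P -> R, mixture_representation s w.

Definition indeterminate (s : 'rV[R]_m) : Prop := ~ determined s.

End Mixtures.

(* Main.v *)
(* T is a convex cone, and it spans R^m: a functional c that vanishes on all
   moment vectors yields, as sigma tends to sigma0, a vanishing combination of
   the a_i.  Hence a basis p_1, ..., p_m of R^m consists of moment vectors, and
   s is interior as soon as s = sum_j e_j p_j + r with e_j > 0 and r in T; when
   all pairs are atoms this follows by averaging decompositions of s.
   Conversely s - c t(x, sigma) stays in T for small c if s is interior.

   A linear relation between atoms of s perturbs a representation containing
   them all into a second one, and any two representations of s differ by such a
   relation.

   If s is a boundary point, a supporting functional gives f in lin A with
   f >= 0 on X by the limit sigma0, whose integral vanishes against every
   component of a representation of s.  If s <> 0 there is such a component, so
   f vanishes on a set with nonempty interior, whence f = 0: a contradiction.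
   So s is interior, and Sigma, having a limit point, is infinite, which makes
   the family over X x Sigma dependent. *)

Require Import Defs.
From HB Require Import structures.
From mathcomp Require Import all_boot all_order all_algebra.
From mathcomp Require Import all_classical all_reals all_analysis.
From mathcomp Require Import lra measurable_realfun.

Set Implicit Arguments.
Unset Strict Implicit.
Unset Printing Implicit Defensive.

Import Order.TTheory GRing.Theory Num.Theory.
Import numFieldNormedType.Exports.

Local Open Scope classical_set_scope.
Local Open Scope ring_scope.

(** * Convex cones and their separation by linear functionals *)

Definition convex_cone (R : numDomainType) (V : lmodType R) (C : set V) : Prop :=
  [/\ C 0, forall x y, C x -> C y -> C (x + y) &
      forall c x, 0 <= c -> C x -> C (c *: x)].

Lemma convex_cone_sum (R : numDomainType) (V : lmodType R) (C : set V)
    (n : nat) (f : 'I_n -> V) :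
  convex_cone C -> (forall i, C (f i)) -> C (\sum_(i < n) f i).
Proof. by move=> [C0 CD _] Cf; apply: (big_ind C). Qed.

Section Separation.
Context (R : realType).

(* Each w is made proportional to e modulo the lineality space of C', where
   theta is the largest t with w - t e in the cone; neither sign of the new
   line can bring -e into the cone. *)
Lemma convex_cone_add_lines (V : lmodType R) (C : set V) (e : V) (ws : seq V) :
  convex_cone C -> (forall x, exists l, C (l *: e + x)) -> ~ C (- e) ->
  exists C' : set V, [/\ convex_cone C', C `<=` C', ~ C' (- e) &
    forall w, w \in ws ->
      exists theta, C' (w - theta *: e) /\ C' (theta *: e - w)].
Proof.
move=> coneC unitC Ce; elim: ws => [|w ws [C' [coneC' CC' C'e C'ws]]].
  by exists C; split.
have [C'0 C'D C'Z] := coneC'.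
have neg_e t : t < 0 -> ~ C' (t *: e).
  move=> t0 /(C'Z (- t^-1)); rewrite oppr_ge0 invr_le0 (ltW t0) => /(_ isT).
  by rewrite scalerA mulNr mulVf ?lt_eqF// scaleN1r.
pose A := [set t | C' (w - t *: e)].
have [l /CC' lw] := unitC w; have [l' /CC' l'w] := unitC (- w).
have A0 : A !=set0 by exists (- l); rewrite /A/= scaleNr opprK addrC.
have ubA : has_ubound A.
  exists l' => t At; rewrite leNgt; apply/negP => l't.
  apply: (@neg_e (l' - t)); first by rewrite subr_lt0.
  rewrite scalerBl; have := C'D _ _ l'w At.
  by rewrite addrA subrK.
pose theta := sup A; pose u := w - theta *: e.
(* The supremum [theta] need not be attained, so [u] itself may lie outside the cone. Only the part
   of the line through [u] shifted by [- t *: e] with [t > 0] has to be kept out. *)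
have C'u t : 0 < t -> ~ C' (u - t *: e).
  move=> t0 h; have := ub_le_sup ubA.
  move=> /(_ (theta + t)); rewrite /A/= scalerDl opprD addrA => /(_ h).
  by rewrite gerDl leNgt t0.
(* Adding [w - r *: e] with [r] in [A] and [r > theta - t / 2] would put a negative multiple of [e]
   into the cone. *)
have C'Nu t : 0 < t -> ~ C' (- u - t *: e).
  move=> t0 h; have [||r Ar tr] := @sup_adherent _ A (t / 2).
  - by rewrite divr_gt0.
  - by split.
  have := C'D _ _ h Ar; apply: contra_not (neg_e (theta - t - r) _); last first.
    by rewrite -/theta in tr; lra.
  rewrite /u opprB [in X in C' X -> _]addrACA => h2.
  suff -> : (theta - t - r) *: e = theta *: e - w + w + (- (t *: e) - r *: e).
    by [].
  by rewrite subrK !scalerBl addrA.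
exists [set x | exists l, C' (x + l *: u)]; split.
- split; first by exists 0; rewrite scale0r addr0.
  + move=> x y [a Ca] [b Cb]; exists (a + b).
    by rewrite scalerDl addrACA; apply: C'D.
  + move=> c x c0 [a Ca]; exists (c * a).
    by rewrite -scalerA -scalerDr; apply: C'Z.
- by move=> x /CC' C'x; exists 0; rewrite scale0r addr0.
(* Dividing by the absolute value of [a] reduces to [C'u] or [C'Nu]. *)
- move=> [a]; have [a0|a0|->] := ltrgtP a 0; last by rewrite scale0r addr0.
  + move=> /(C'Z (- a^-1)); rewrite oppr_ge0 invr_le0 (ltW a0) => /(_ isT).
    rewrite scalerDr scalerN scaleNr opprK scalerA mulNr mulVf ?lt_eqF//.
    rewrite scaleN1r addrC => h; apply: (@C'Nu (- a^-1)).
      by rewrite oppr_gt0 invr_lt0.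
    by rewrite scaleNr opprK.
  + move=> /(C'Z a^-1); rewrite invr_ge0 (ltW a0) => /(_ isT).
    rewrite scalerDr scalerN scalerA mulVf ?gt_eqF// scale1r addrC.
    by apply: C'u; rewrite invr_gt0.
- move=> x; rewrite inE => /orP[/eqP ->|/C'ws [t [h1 h2]]].
    exists theta; split; first by exists (-1); rewrite scaleN1r subrr.
    by exists 1; rewrite scale1r /u addrC subrKA subrr.
  by exists t; split; exists 0; rewrite scale0r addr0.
Qed.

(** Let [c i] be the multiple of [e] to which the [i]-th coordinate vector is congruent modulo the
    lineality space of the enlarged cone. Then every [x] is congruent to its value times [e], so a
    negative value on [C] would bring [- e] into the cone, and so would [c = 0]. *)
Lemma convex_cone_nonneg_functional (m : nat) (C : set 'rV[R]_m)
    (e : 'rV[R]_m) :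
  convex_cone C -> (forall x, exists l, C (l *: e + x)) -> ~ C (- e) ->
  exists2 c : 'I_m -> R, exists i, c i != 0 &
    forall x, C x -> 0 <= \sum_(i < m) c i * x 0 i.
Proof.
move=> coneC unitC Ce.
have [C' [coneC' CC' C'e C'w]] :=
  convex_cone_add_lines [seq delta_mx 0 i | i : 'I_m] coneC unitC Ce.
have /choice[c hc] (i : 'I_m) :
    exists t, C' (delta_mx 0 i - t *: e) /\ C' (t *: e - delta_mx 0 i).
  by apply: C'w; apply: fintype.image_f.
have [C'0 C'D C'Z] := coneC'.
have C'proj (x : 'rV[R]_m) : C' (x - (\sum_(i < m) c i * x 0 i) *: e).
  rewrite {1}[x]row_sum_delta scaler_suml -sumrB.
  apply: convex_cone_sum => // i; have [h1 h2] := hc i.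
  rewrite mulrC -scalerA -scalerBr; have [x0|x0] := leP 0 (x 0 i).
    exact: C'Z.
  rewrite -opprB scalerN -scaleNr; apply: C'Z => //.
  by rewrite oppr_ge0 ltW.
exists c.
  apply: contrapT => c0; apply: C'e.
  have := C'proj (- e); rewrite big1 ?scale0r ?subr0// => i _.
  have [->|ci] := eqVneq (c i) 0; first by rewrite mul0r.
  by case: c0; exists i.
move=> x Cx; rewrite leNgt; apply/negP; set f := \sum_(i < m) _ => f0.
apply: C'e; have := C'D _ _ (C'proj (- x)) (CC' _ Cx).
have -> : \sum_(i < m) c i * (- x) 0 i = - f.
  by rewrite -sumrN; apply: eq_bigr => i _; rewrite mxE mulrN.
rewrite scaleNr opprK addrAC addNr add0r => /(C'Z (- f^-1)).
rewrite oppr_ge0 invr_le0 (ltW f0) => /(_ isT).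
by rewrite scalerA mulNr mulVf ?lt_eqF// scaleN1r.
Qed.

End Separation.

(** * Conic combinations, reduction of their length, and atoms *)

Lemma dependent_rows (F : fieldType) (m k : nat) (w : 'I_k -> 'rV[F]_m) :
  (m < k)%N ->
  exists2 u : 'I_k -> F, exists i, u i != 0 & \sum_(i < k) u i *: w i = 0.
Proof.
move=> mk; pose M := \matrix_(i < k) w i.
have : kermx M != 0.
  rewrite kermx_eq0 /row_free ltn_eqF//.
  exact: leq_ltn_trans (rank_leq_col M) mk.
move=> /rowV0Pn[u /sub_kermxP uM /rV0Pn[i ui]].
exists (fun i => u 0 i); first by exists i.
rewrite -[RHS]uM mulmx_sum_row; apply: eq_bigr => j _.
by rewrite rowK.
Qed.

Section ConicCombinations.
Context (R : realType) (m : nat) (I : eqType).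
Variables (v : I -> 'rV[R]_m) (D : set I).

Definition conic_sum (k : nat) (s : 'rV[R]_m) : Prop :=
  exists (c : 'I_k -> R) (p : 'I_k -> I),
    [/\ forall i, 0 <= c i, forall i, D (p i) & s = \sum_(i < k) c i *: v (p i)].

Definition fcons (A : Type) (k : nat) (x : A) (f : 'I_k -> A) : 'I_k.+1 -> A :=
  fun i => oapp f x (unlift ord0 i).

Lemma fcons0 (A : Type) (k : nat) (x : A) (f : 'I_k -> A) :
  fcons x f ord0 = x.
Proof. by rewrite /fcons unlift_none. Qed.

Lemma fconsS (A : Type) (k : nat) (x : A) (f : 'I_k -> A) (i : 'I_k) :
  fcons x f (lift ord0 i) = f i.
Proof. by rewrite /fcons liftK. Qed.

Lemma fcons_ind (A : Type) (Q : A -> Prop) (k : nat) (x : A) (f : 'I_k -> A) :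
  Q x -> (forall i, Q (f i)) -> forall i, Q (fcons x f i).
Proof.
by move=> Qx Qf i; case: (unliftP ord0 i) => [j|] ->; rewrite ?fconsS ?fcons0.
Qed.

Lemma conic_sumS k c q s : 0 <= c -> D q -> conic_sum k s ->
  conic_sum k.+1 (c *: v q + s).
Proof.
move=> c0 Dq [d [p [d0 Dp ->]]]; exists (fcons c d), (fcons q p); split.
- exact: (@fcons_ind _ (fun a => 0 <= a)).
- exact: fcons_ind.
- rewrite big_ord_recl !fcons0; congr (_ + _).
  by apply: eq_bigr => i _; rewrite !fconsS.
Qed.

(** The reduction step of Caratheodory: the coefficients are moved along a linear relation until the
    first one vanishes. *)
Lemma conic_sum_drop k s : (m <= k)%N -> conic_sum k.+1 s -> conic_sum k s.
Proof.
move=> mk [c [p [c0 Dp ->]]].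
have [u [i0 ui0] u_eq0] : exists2 u : 'I_k.+1 -> R, exists i, 0 < u i &
    \sum_(i < k.+1) u i *: v (p i) = 0.
  have [u [i ui] u0] := @dependent_rows _ m k.+1 (v \o p) mk.
  have [ui0|ui0] := ltP 0 (u i); first by exists u => //; exists i.
  exists (fun i => - u i); first by exists i; rewrite oppr_gt0 lt_neqAle ui.
  by under eq_bigr do rewrite scaleNr; rewrite sumrN u0 oppr0.
(* The minimal ratio [c j / u j] over positive [u j] is the largest step that keeps all coefficients
   nonnegative, and it cancels the [j]-th one. *)
have [j uj jmin] := @Order.TotalTheory.arg_minP _ _ _ i0
  (fun i => 0 < u i) (fun i => c i / u i) ui0.
pose t := c j / u j.
exists (fun i : 'I_k => c (lift j i) - t * u (lift j i)),
  (fun i : 'I_k => p (lift j i)).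
split => [i|i|].
- rewrite subr_ge0; set l := lift j i.
  have [ul|ul] := ltP 0 (u l); first by rewrite -ler_pdivlMr// jmin.
  by apply: le_trans (c0 l); rewrite mulr_ge0_le0// divr_ge0// ltW.
- exact: Dp.
- transitivity (\sum_(i < k.+1) (c i - t * u i) *: v (p i)).
    under [RHS]eq_bigr do rewrite scalerBl -scalerA.
    by rewrite sumrB -scaler_sumr u_eq0 scaler0 subr0.
  by rewrite (@bigD1_ord _ _ _ _ j)//= /t divfK ?gt_eqF// subrr scale0r add0r.
Qed.

(** Long sums are shortened by [conic_sum_drop]; short ones are padded with zero coefficients, for
    which an element of [D] must exist. *)
Lemma conic_sum_dim k s : D !=set0 -> conic_sum k s -> conic_sum m s.
Proof.
move=> [q Dq] sk; have [mk|/ltnW km] := leqP m k.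
  rewrite -(subnKC mk) in sk; elim: (k - m)%N sk => [|n IHn].
    by rewrite addn0.
  by rewrite addnS => /(conic_sum_drop (leq_addr _ _)).
rewrite -(subnKC km); elim: (m - k)%N => [|n IHn]; first by rewrite addn0.
by rewrite addnS -[s]add0r -(scale0r (v q)); apply: conic_sumS.
Qed.

Lemma conic_sumD k l s r :
  conic_sum k s -> conic_sum l r -> conic_sum (k + l) (s + r).
Proof.
elim: k s => [|k IHk] s [c [p [c0 Dp ->]]] rl; first by rewrite big_ord0 add0r.
rewrite big_ord_recl -addrA; apply: conic_sumS => //; apply: IHk => //.
by exists (c \o lift ord0), (p \o lift ord0); split => // i /=.
Qed.

Lemma conic_sum_cone : D !=set0 -> convex_cone (conic_sum m).
Proof.
move=> D0; split.
- apply: (@conic_sum_dim 0) => //; have [q Dq] := D0.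
  by exists (fun=> 0), (fun=> q); split; rewrite // big_ord0.
- by move=> s r sm rm; apply: (@conic_sum_dim (m + m)) => //; apply: conic_sumD.
- move=> t s t0 [c [p [c0 Dp ->]]]; exists (fun i => t * c i), p; split => //.
    by move=> i; rewrite mulr_ge0.
  by rewrite scaler_sumr; under eq_bigr do rewrite scalerA.
Qed.

Lemma conic_sum_gen q : D q -> conic_sum m (v q).
Proof.
move=> Dq; apply: (@conic_sum_dim 1); first by exists q.
by exists (fun=> 1), (fun=> q); split; rewrite // big_ord1 scale1r.
Qed.

(** This is [mixture_representation] over an abstract index type: [w] collects the total weight of
    each index. *)
Definition positive_sum (s : 'rV[R]_m) (w : I -> R) : Prop :=
  exists (k : nat) (c : 'I_k -> R) (p : 'I_k -> I),
    [/\ forall i, 0 < c i, forall i, D (p i),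
        w = (fun q => \sum_(i < k | p i == q) c i) &
        s = \sum_(i < k) c i *: v (p i)].

Definition atom (s : 'rV[R]_m) (q : I) : Prop :=
  D q /\ exists2 c : R, 0 < c & exists r w, positive_sum r w /\ s = c *: v q + r.

Lemma positive_sumS c q s w : 0 < c -> D q -> positive_sum s w ->
  positive_sum (c *: v q + s) (fun q' => (if q == q' then c else 0) + w q').
Proof.
move=> c0 Dq [k [d [p [d0 Dp -> ->]]]].
exists k.+1, (fcons c d), (fcons q p); split.
- exact: (@fcons_ind _ (fun a => 0 < a)).
- exact: fcons_ind.
- apply/funext => q'; rewrite [RHS]big_mkcond big_ord_recl !fcons0 [in LHS]big_mkcond.
  by congr (_ + _); apply: eq_bigr => i _; rewrite !fconsS.
- rewrite big_ord_recl !fcons0; congr (_ + _).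
  by apply: eq_bigr => i _; rewrite !fconsS.
Qed.

Lemma positive_sum_combine (n : nat) (d : 'I_n -> R) (p : 'I_n -> I) s w :
  (forall i, 0 < d i) -> (forall i, D (p i)) -> positive_sum s w ->
  positive_sum (\sum_(i < n) d i *: v (p i) + s)
    (fun q => \sum_(i < n | p i == q) d i + w q).
Proof.
elim: n d p => [|n IHn] d p d0 Dp sw.
  have -> : (fun q => \sum_(i < 0 | p i == q) d i + w q) = w.
    by apply/funext => q; rewrite big_mkcond big_ord0 add0r.
  by rewrite big_ord0 add0r.
have -> : (fun q => \sum_(i < n.+1 | p i == q) d i + w q) =
    (fun q => (if p ord0 == q then d ord0 else 0) +
      (\sum_(i < n | p (lift ord0 i) == q) d (lift ord0 i) + w q)).
  apply/funext => q; rewrite [in LHS]big_mkcond big_ord_recl -addrA.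
  by rewrite [in RHS]big_mkcond.
rewrite big_ord_recl -addrA.
apply: positive_sumS => //.
by apply: (IHn (d \o lift ord0) (p \o lift ord0)) => // i /=.
Qed.

Lemma positive_sum_exists k s : conic_sum k s -> exists w, positive_sum s w.
Proof.
elim: k s => [|k IHk] s [c [p [c0 Dp ->]]].
  by exists (fun q => \sum_(i < 0 | p i == q) c i), 0, c, p; split => // -[].
rewrite big_ord_recl.
have [|w hw] := IHk (\sum_(i < k) c (lift ord0 i) *: v (p (lift ord0 i))).
  by exists (c \o lift ord0), (p \o lift ord0); split => // i /=.
have [->|c00] := eqVneq (c ord0) 0; first by exists w; rewrite scale0r add0r.
eexists; apply: positive_sumS hw => //.
by rewrite lt_neqAle eq_sym c00 c0.
Qed.

Lemma positive_sum_conic s w :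
  D !=set0 -> positive_sum s w -> conic_sum m s.
Proof.
move=> D0 [k [c [p [c0 Dp _ ->]]]]; apply: (@conic_sum_dim k) => //.
by exists c, p; split => // i; rewrite ltW.
Qed.

Lemma atomP s q : D !=set0 ->
  atom s q <-> D q /\ exists2 c : R, 0 < c & exists2 r, conic_sum m r & s = c *: v q + r.
Proof.
move=> D0; split => -[Dq [c c0]].
  move=> [r [w [rw sE]]]; split => //; exists c => //; exists r => //.
  exact: positive_sum_conic rw.
move=> [r /positive_sum_exists[w rw] sE]; split => //; exists c => //.
by exists r, w.
Qed.

Lemma atoms_decomposition (n : nat) (p : 'I_n -> I) s :
  D !=set0 -> conic_sum m s -> (forall i, atom s (p i)) ->
  exists2 e : 'I_n -> R, forall i, 0 < e i &
    exists2 r, conic_sum m r & s = \sum_(i < n) e i *: v (p i) + r.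
Proof.
move=> D0 sm ps; have coneT := conic_sum_cone D0; have [_ TD TZ] := coneT.
have /choice[er her] (i : 'I_n) : exists er : R * 'rV[R]_m,
    [/\ 0 < er.1, conic_sum m er.2 & s = er.1 *: v (p i) + er.2].
  by have /(atomP _ _ D0)[_ [c c0 [r rm sE]]] := ps i; exists (c, r).
(* The average is over the [n] decompositions and one more copy of [s], which also covers
   [n = 0]. *)
pose N : R := n.+1%:R; have N0 : 0 < N by rewrite ltr0n.
exists (fun i => N^-1 * (er i).1).
  by move=> i; have [e0 _ _] := her i; rewrite mulr_gt0// invr_gt0.
exists (N^-1 *: (s + \sum_(i < n) (er i).2)).
  apply: TZ; first by rewrite invr_ge0 ltW.
  by apply: TD => //; apply: convex_cone_sum => // i; have [] := her i.
under eq_bigr do rewrite -scalerA.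
rewrite -scaler_sumr -scalerDr addrCA -big_split /=.
rewrite (eq_bigr (fun=> s)); last by move=> i _; have [_ _ <-] := her i.
rewrite sumr_const card_ord -mulrS -scaler_nat scalerA mulVf ?scale1r//.
by rewrite gt_eqF.
Qed.

End ConicCombinations.

(** * Uniqueness of representations and linear independence of atoms *)

Section Determinacy.
Context (R : realType) (m : nat) (I : eqType).
Variables (v : I -> 'rV[R]_m) (D : set I).

(** The last clause allows any duplicate-free list containing the components, so that two
    representations can be summed over one common list. *)
Lemma positive_sum_support s w : positive_sum v D s w ->
  exists S : seq I, [/\ forall q, q \in S -> atom v D s q,
    forall q, q \notin S -> w q = 0 &
    forall S' : seq I, uniq S' -> {subset S <= S'} ->
      s = \sum_(q <- S') w q *: v q].
Proof.
move=> [k [c [p [c0 Dp -> sE]]]]; exists [seq p i | i <- enum 'I_k]; split.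
- move=> q /mapP[j _ ->]; split; first exact: Dp.
  case: k c p c0 Dp sE j => [|k] c p c0 Dp sE j; first by case: j.
  exists (c j) => //; exists (\sum_(i < k) c (lift j i) *: v (p (lift j i))).
  exists (fun q' => \sum_(i < k | p (lift j i) == q') c (lift j i)).
  split; last by rewrite sE (@bigD1_ord _ _ _ _ j).
  by exists k, (fun i => c (lift j i)), (fun i => p (lift j i)).
- move=> q qS; rewrite big_pred0// => i; apply/negbTE.
  apply: contra qS => /eqP <-; apply: map_f; exact: mem_enum.
- move=> S' uS' SS'; rewrite sE.
  under [RHS]eq_bigr do rewrite scaler_suml.
  rewrite (exchange_big_dep xpredT)//=; apply: eq_bigr => i _.
  have piS' : p i \in S' by apply: SS'; apply: map_f; exact: mem_enum.
  rewrite (eq_bigl (fun q => q == p i)); last by move=> q; rewrite eq_sym.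
  by rewrite -big_filter filter_pred1_uniq// big_seq1.
Qed.

Lemma linearly_independent_positive_sum s w1 w2 :
  linearly_independent (atom v D s) v ->
  positive_sum v D s w1 -> positive_sum v D s w2 -> w1 = w2.
Proof.
move=> indep /positive_sum_support[S1 [S1s w1S S1E]].
move=> /positive_sum_support[S2 [S2s w2S S2E]].
pose S := undup (S1 ++ S2).
have S1S : {subset S1 <= S} by move=> q qS; rewrite mem_undup mem_cat qS.
have S2S : {subset S2 <= S} by move=> q qS; rewrite mem_undup mem_cat qS orbT.
have uS : uniq S by exact: undup_uniq.
have Ss q : q \in S -> atom v D s q.
  by rewrite mem_undup mem_cat => /orP[/S1s|/S2s].
apply/funext => q; have [qS|qS] := boolP (q \in S); last first.
  have qS1 : q \notin S1 by apply: contra qS => /S1S.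
  have qS2 : q \notin S2 by apply: contra qS => /S2S.
  by rewrite w1S// w2S.
pose p := tnth (in_tuple S).
(* The difference of the two weight functions is a linear relation between atoms. *)
have := indep (size S) p (fun i => w1 (p i) - w2 (p i)).
case/tnthP: (qS : q \in in_tuple S) => i ->.
move=> H; apply/eqP; rewrite -subr_eq0; apply/eqP; apply: H.
- by move=> j l; apply: contraPP => /eqP jl; apply/eqP; apply: contra jl;
    rewrite /p !(tnth_nth q) nth_uniq.
- by move=> j; apply: Ss; apply: mem_tnth.
- have h (w : I -> R) : s = \sum_(q <- S) w q *: v q ->
      s = \sum_j w (p j) *: v (p j).
    by move=> sw; rewrite {1}sw (big_tnth _ _ S).
  under eq_bigr do rewrite scalerBl.
  by rewrite sumrB -(h _ (S1E _ uS S1S)) -(h _ (S2E _ uS S2S)) subrr.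
Qed.

(** A relation [c] between atoms, scaled by a small [t], changes a representation that contains all
    of them into another representation of [s]; uniqueness forces [c = 0]. *)
Lemma positive_sum_unique_linearly_independent s w0 :
  D !=set0 -> conic_sum v D m s ->
  (forall w, positive_sum v D s w -> w = w0) ->
  linearly_independent (atom v D s) v.
Proof.
move=> D0 sm w_uniq n p c pinj ps cp0 i0.
have [e e0 [r /positive_sum_exists[w rw] sE]] := atoms_decomposition D0 sm ps.
(* The sum dominates each [|c i| / e i], hence [t * |c i| < e i] and the perturbed weights stay
   positive. *)
pose t := (1 + \sum_(i < n) `|c i| / e i)^-1.
have S0 : 0 <= \sum_(i < n) `|c i| / e i.
  by apply: sumr_ge0 => i _; rewrite divr_ge0// ltW.
have t0 : 0 < t by rewrite invr_gt0 ltr_pwDl.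
have et0 i : 0 < e i + t * c i.
  rewrite -[t * c i]opprK subr_gt0 -mulrN; apply: le_lt_trans (_ : t * `|c i| < _).
    by rewrite ler_pM2l// -normrN ler_norm.
  rewrite mulrC -ltr_pdivlMr// invrK mulrC -ltr_pdivrMr//.
  rewrite (bigD1 i)//= addrCA ltrDl ltr_pwDl// sumr_ge0// => j _.
  by rewrite divr_ge0// ltW.
have Dp i : D (p i) by have [] := ps i.
have h1 := positive_sum_combine e0 Dp rw.
have h2 := positive_sum_combine et0 Dp rw.
rewrite -sE in h1; have sE2 : \sum_(i < n) (e i + t * c i) *: v (p i) + r = s.
  rewrite sE; congr (_ + _); under eq_bigr do rewrite scalerDl -scalerA.
  by rewrite big_split/= -scaler_sumr cp0 scaler0 addr0.
rewrite sE2 in h2.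
(* Evaluated at [p i0], the weights of the remainder cancel, and injectivity of [p] leaves
   [e i0 = e i0 + t * c i0]. *)
have := w_uniq _ h1; rewrite -(w_uniq _ h2) => /(congr1 (@^~ (p i0))) /addIr.
rewrite !(big_pred1 i0); last 2 first.
- by move=> i; rewrite /= (inj_eq pinj).
- by move=> i; rewrite /= (inj_eq pinj).
rewrite -{1}[e i0]addr0 => /addrI/esym/eqP.
by rewrite mulf_eq0 gt_eqF//= => /eqP.
Qed.

Lemma infinite_atoms_dependent (W : set I) (f : nat -> I) :
  injective f -> (forall i, W (f i)) -> ~ linearly_independent W v.
Proof.
move=> finj fW indep.
have [u [i ui] u0] := @dependent_rows R m m.+1 (fun i => v (f i)) (ltnSn m).
apply/negP: ui; rewrite negbK; apply/eqP.
apply: (indep m.+1 (fun i => f i) u _ _ u0 i) => [j l /finj/val_inj//|j].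
exact: fW.
Qed.

End Determinacy.

(** * Interior and boundary points of cones in finite dimension *)

Section Interior.
Context (R : realType) (m : nat).

Lemma near_ge_coord_mulmx (N : 'M[R]_m) (e : 'I_m -> R) (s : 'rV[R]_m) :
  (forall i, 0 < e i) ->
  \forall y \near s, forall i, - e i <= ((y - s) *m N) 0 i.
Proof.
move=> e0; have Fs : Filter (nbhs s) by exact: nbhs_filter.
have coord_cvg i : ((y - s) *m N) 0 i @[y --> s] --> (0 : R).
  have -> : (0 : R) = \sum_(j < m) (s 0 j - s 0 j) * N j i.
    by rewrite big1// => j _; rewrite subrr mul0r.
  under eq_fun => y.
    rewrite mxE; under eq_bigr do rewrite !mxE; over.
  apply: cvg_big => [|j _].
    exact: (@pseudometric_normed_Zmodule.add_continuous _ R^o).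
  apply: cvgMr_tmp; apply: (@cvgB _ R^o);
    [exact: coord_continuous|exact: cvg_cst].
have := @filter_forall 'rV[R]_m 'I_m
  (fun i y => - e i <= ((y - s) *m N) 0 i) (nbhs s) Fs.
apply=> i; apply: (cvgr_ge _ (coord_cvg i)).
by rewrite oppr_lt0.
Qed.

(** Moving to a nearby point changes the coordinates in the basis [B] by little, so the coefficients
    [e i] stay nonnegative and [r] is kept. *)
Lemma cone_interior (C : set 'rV[R]_m) (B : 'M[R]_m) (e : 'I_m -> R)
    (r : 'rV[R]_m) :
  convex_cone C -> B \in unitmx -> (forall i, C (row i B)) ->
  (forall i, 0 < e i) -> C r -> C° (\sum_(i < m) e i *: row i B + r).
Proof.
move=> coneC Bunit CB e0 Cr; have [_ CD CZ] := coneC; set s := _ + r.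
have := near_ge_coord_mulmx (invmx B) s e0.
apply: filterS => y hy.
have -> : y = \sum_(i < m) (e i + ((y - s) *m invmx B) 0 i) *: row i B + r.
  under eq_bigr do rewrite scalerDl.
  rewrite big_split/= -mulmx_sum_row -mulmxA mulVmx// mulmx1.
  by rewrite addrAC -/s addrC subrK.
apply: CD => //; apply: convex_cone_sum => // i.
by apply: CZ => //; rewrite -lerBlDl sub0r.
Qed.

Lemma interior_sub_scale (C : set 'rV[R]_m) (s u : 'rV[R]_m) :
  C° s -> exists2 c : R, 0 < c & C (s - c *: u).
Proof.
move=> Cs.
have : (s - c *: u) @[c --> (0 : R)] --> s.
  rewrite -[X in _ --> X]subr0 -(scale0r u).
  by apply: cvgB; [exact: cvg_cst|apply: cvgZr_tmp; exact: cvg_id].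
move=> /(_ _ Cs) /= h.
have /filter_ex[c [c0 Cc]] : \forall c \near (0 : R)^'+, 0 < c /\ C (s - c *: u).
  near=> c; split; first by near: c; exact: nbhs_right_gt.
  by near: c; apply: cvg_within.
by exists c.
Unshelve. all: by end_near. Qed.

(* A maximal linearly independent set of rows taken from W is found greedily:
   a nonzero functional killing fewer than m rows does not kill all of W. *)
Lemma spanning_basis (W : set 'rV[R]_m) :
  (forall c : 'I_m -> R, (forall u, W u -> \sum_(i < m) c i * u 0 i = 0) ->
     forall i, c i = 0) ->
  exists2 B : 'M[R]_m, B \in unitmx & forall i, W (row i B).
Proof.
move=> Wspan.
suff h k : (k <= m)%N ->
    exists2 B : 'M[R]_(k, m), row_free B & forall i, W (row i B).
  by have [B] := h m (leqnn m); rewrite row_free_unit; exists B.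
elim: k => [_|k IHk km].
  exists 0; last by case.
  by rewrite /row_free mxrank0.
have [B Bfree WB] := IHk (ltnW km).
(* With fewer than [m] rows the cokernel matrix is nonzero; its column [j] is a nonzero functional
   that kills the rows of [B]. *)
have [i [j Kij]] : exists i j, cokermx B i j != 0.
  apply: contrapT => h; have /eqP[] : cokermx B != 0.
    by rewrite cokermx_eq0 /row_full (eqP Bfree) ltn_eqF.
  apply/matrixP => i j; rewrite [RHS]mxE; apply: contrapT => /eqP Kij.
  by apply: h; exists i, j.
have [u Wu uK] : exists2 u, W u & (u *m cokermx B) 0 j != 0.
  apply: contrapT => h; case/eqP: Kij.
  apply: (Wspan (fun i => cokermx B i j)) => u Wu; apply: contrapT => /eqP uK.
  apply: h; exists u => //; rewrite mxE; move: uK.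
  by under eq_bigr do rewrite mulrC.
exists (col_mx u B); last first.
  move=> l; have [l'|l'] := split_ordP (l : 'I_(1 + k)) => ->.
    suff : W (row (lshift k l') (col_mx u B)) by [].
    by rewrite rowKu (ord1 l') row_id.
  suff : W (row (rshift 1 l') (col_mx u B)) by [].
  by rewrite rowKd.
suff : @row_free _ (1 + k) m (col_mx u B) by [].
apply: inj_row_free => x; rewrite -[x]hsubmxK mul_row_col => xB.
(* Applying that functional to the relation leaves only the coefficient of the new row [u]. *)
have x0 : lsubmx x = 0.
  have := congr1 (fun y => (y *m cokermx B) 0 j) xB.
  rewrite mulmxDl -!mulmxA mulmx_coker mulmx0 addr0 mul0mx !mxE big_ord1.
  move=> /eqP; rewrite mulf_eq0 => /orP[/eqP x0|]; last first.
    by rewrite (negbTE uK).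
  by apply/rowP => l; rewrite (ord1 l) [LHS]x0 mxE.
move: xB; rewrite x0 mul0mx add0r => /eqP.
rewrite mulmx_free_eq0// => /eqP ->.
by rewrite row_mx0.
Qed.

End Interior.

(** The separation is applied to [K], the cone generated by [C] and [- s], so that the functional is
    nonnegative on [C] and at most zero at [s]. *)
Lemma supporting_functional (R : realType) (m : nat) (C : set 'rV[R]_m)
    (B : 'M[R]_m) (s : 'rV[R]_m) :
  convex_cone C -> B \in unitmx -> (forall i, C (row i B)) -> C s -> ~ C° s ->
  exists2 c : 'I_m -> R, exists i, c i != 0 &
    (forall x, C x -> 0 <= \sum_(i < m) c i * x 0 i) /\
    \sum_(i < m) c i * s 0 i <= 0.
Proof.
move=> coneC Bunit CB Cs intCs; have [C0 CD CZ] := coneC.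
pose e := \sum_(i < m) row i B.
pose K := [set x : 'rV[R]_m | exists2 l, 0 <= l & C (x + l *: s)].
have CK : C `<=` K by move=> x Cx; exists 0 => //; rewrite scale0r addr0.
have coneK : convex_cone K.
  split; first exact: CK.
  - move=> x y [k k0 Ck] [l l0 Cl]; exists (k + l); first exact: addr_ge0.
    by rewrite scalerDl addrACA; apply: CD.
  - move=> t x t0 [k k0 Ck]; exists (t * k); first exact: mulr_ge0.
    by rewrite -scalerA -scalerDr; apply: CZ.
have [||c c0 cK] := @convex_cone_nonneg_functional R m K e coneK.
- move=> x; pose z := x *m invmx B.
  (* This multiple of [e] makes every coordinate in the basis [B] nonnegative. *)
  exists (\sum_(i < m) `|z 0 i|); apply: CK.
  have -> : x = \sum_(i < m) z 0 i *: row i B.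
    by rewrite -mulmx_sum_row -mulmxA mulVmx// mulmx1.
  rewrite /e scaler_sumr -big_split; apply: convex_cone_sum => // i /=.
  rewrite -scalerDl; apply: CZ => //.
  rewrite (bigD1 i)//= addrAC addr_ge0//; last exact: sumr_ge0.
  by rewrite -{2}[z 0 i]opprK subr_ge0 -normrN ler_norm.
(* If [- e + l *: s] is in [C], then [(1 + l) *: s] is [e] plus an element of [C], which makes [s]
   interior. *)
- move=> [l l0 Cl]; apply: intCs.
  have l1 : 0 < 1 + l by rewrite ltr_pwDl.
  have -> : s = \sum_(i < m) (1 + l)^-1 *: row i B
                + (1 + l)^-1 *: (s + (- e + l *: s)).
    rewrite -scaler_sumr -/e -scalerDr addrCA addNKr.
    rewrite -{2}[s]scale1r -scalerDl scalerA mulVf ?scale1r//.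
    by rewrite gt_eqF.
  apply: cone_interior => //; first by move=> _; rewrite invr_gt0.
  by apply: CZ; [rewrite invr_ge0 ltW|apply: CD].
- exists c => //; split; first by move=> x /CK; exact: cK.
  have /cK : K (- s) by exists 1 => //; rewrite scale1r addNr.
  under eq_bigr do rewrite mxE mulrN.
  by rewrite sumrN oppr_ge0.
Qed.

(** * Integrals of continuous functions, and limits at limit points *)

Section BorelIntegrals.
Context (R : realType) (X : ptopologicalType).

Lemma continuous_borel_measurable (f : X -> R) :
  continuous f -> measurable_fun [set: borel X] (f : borel X -> R).
Proof.
move=> /continuousP cf; apply: (measurability _ (RGenOpens.measurableE R)).
move=> _ [_ [a [b ->] <-]]; rewrite setTI; apply: sub_sigma_algebra.
exact/cf/interval_open.
Qed.

(** The integral is the difference of those of the positive and negative parts. As [+oo - +oo] is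
    again infinite in the extended reals of the library, a finite value forces both parts to be
    finite. *)
Lemma integrable_abs_integral_lty d (T : measurableType d)
    (mu : {measure set T -> \bar R}) (f : T -> \bar R) :
  measurable_fun [set: T] f -> (`|\int[mu]_x f x| < +oo)%E ->
  mu.-integrable [set: T] f.
Proof.
move=> mf intf; apply/integrableP; split => //.
under eq_integral do rewrite -[(`|f _|)%E]/((abse \o f) _) fune_abse.
rewrite ge0_integralD//=; last 2 first.
- exact: measurable_funepos.
- exact: measurable_funeneg.
move: intf; rewrite integralE.
have : (0 <= \int[mu]_x f^\+ x)%E by apply: integral_ge0.
have : (0 <= \int[mu]_x f^\- x)%E by apply: integral_ge0.
case: (\int[mu]_x f^\+ x)%E => [x| |]//; case: (\int[mu]_x f^\- x)%E => [y| |]//.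
by move=> _ _ _; rewrite -EFinD ltry.
Qed.

(** The open set where [f > 0] is null, so it contains no point of the support. *)
Lemma continuous_integral0_support
    (mu : {measure set (borel X) -> \bar R}) (f : X -> R) x :
  continuous f -> (forall y, 0 <= f y) -> (\int[mu]_y (f y)%:E)%E = 0%E ->
  measure_support mu x -> f x = 0.
Proof.
move=> cf f0 intf supp_x; apply/eqP; rewrite eq_le f0 andbT leNgt.
apply/negP => fx0.
have mf := continuous_borel_measurable cf.
have openU : open (f @^-1` [set r | 0 < r]).
  by move/continuousP : cf; apply; exact: open_gt.
have := supp_x _ openU fx0.
have : ae_eq mu setT (EFin \o (f : borel X -> R)) (cst 0%E).
  apply/ae_eq_integral_abs => //; first exact/measurable_EFinP.
  rewrite -[RHS]intf; apply: eq_integral => y _ /=.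
  by rewrite ger0_norm.
move=> [N [mN N0 subN]].
suff -> : mu (f @^-1` [set r | 0 < r]) = 0%E by rewrite ltxx.
apply: (subset_measure0 _ mN _ N0); first exact: sub_sigma_algebra.
move=> y /= fy; apply: subN => /= /(_ Logic.I) [] fy0.
by rewrite fy0 ltxx in fy.
Qed.

End BorelIntegrals.

(** If [A] were finite, the complement of [A] minus [x] would be a neighborhood of [x] without
    further points of [A]. *)
Lemma limit_point_infinite_set (T : topologicalType) (A : set T) (x : T) :
  accessible_space T -> limit_point A x -> infinite_set A.
Proof.
move=> /accessible_finite_set_closed fin_closed Ax finA.
have : closed (A `\ x).
  by apply: fin_closed; exact: finite_setD.
rewrite -openC => oA.
have [|y [yx Ay Ny]] := Ax (~` (A `\ x)).
  by apply: open_nbhs_nbhs; split => // -[_]; apply.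
by apply: Ny; split => //= yxE; rewrite yxE eqxx in yx.
Qed.

Lemma has_limit_in_ge0 (T : topologicalType) (R : realType) (A : set T)
    (x : T) (f : T -> R) (l : R) :
  has_limit_in A x f l -> (forall y, A y -> 0 <= f y) -> 0 <= l.
Proof.
move=> [Ax fl] f0.
(* The limit passes to inequalities because the punctured filter is proper, which is what the limit
   point provides. *)
have PF : ProperFilter (within A x^').
  apply: Build_ProperFilter_ex => B /Ax[y [yx Ay By]].
  by exists y; apply: By.
by apply: (cvgr_to_ge fl); near=> y; apply: f0; near: y; exact: withinT.
Unshelve. all: by end_near. Qed.

(** * The moment cone, its atoms and its interior *)

Section MomentCone.
Context (R : realType) (X : ptopologicalType) (P : metricType R) (m : nat).
Variables (a : 'I_m -> X -> R) (delta : X -> P -> probability (borel X) R).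
Variable Sigma : set P.

Let I : eqType := (X * P)%type.
Let t (q : I) : 'rV[R]_m := moment_vector a delta q.1 q.2.
Let D : set I := [set q | Sigma q.2].

Lemma moment_coneE : moment_cone a delta Sigma = conic_sum t D m.
Proof.
apply/seteqP; split => s.
  move=> [c [x [sigma [c0 Ssigma ->]]]].
  by exists c, (fun i => (x i, sigma i)).
move=> [c [p [c0 Dp ->]]].
by exists c, (fun i => (p i).1), (fun i => (p i).2).
Qed.

Lemma mixture_representationE s w :
  mixture_representation a delta Sigma s w <-> positive_sum t D s w.
Proof.
split.
  move=> [k [c [x [sigma [c0 Ssigma -> ->]]]]].
  by exists k, c, (fun i => (x i, sigma i)).
move=> [k [c [p [c0 Dp -> ->]]]].
exists k, c, (fun i => (p i).1), (fun i => (p i).2); split => //.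
Qed.

Lemma atomsE s : atoms a delta Sigma s = atom t D s.
Proof.
apply/seteqP; split => q.
  move=> [Dq [k [c [ci [x [sigma [c0 ci0 Ssigma ->]]]]]]]; split => //.
  exists c => //; eexists; eexists; split; last by [].
  by exists k, ci, (fun i => (x i, sigma i)).
move=> [Dq [c c0 [r [w [[k [ci [p [ci0 Dp _ ->]]]] ->]]]]]; split => //.
by exists k, c, ci, (fun i => (p i).1), (fun i => (p i).2).
Qed.

(** Membership in the cone supplies a representation, so being determined is a matter of uniqueness
    alone. *)
Lemma indeterminateP s : D !=set0 -> moment_cone a delta Sigma s ->
  indeterminate a delta Sigma s <->
  ~ linearly_independent (atoms a delta Sigma s) t.
Proof.
rewrite moment_coneE atomsE => D0 sm; split; apply: contra_not.
  move=> indep; have [w sw] := positive_sum_exists sm.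
  exists w; split; first exact/mixture_representationE.
  move=> w' /mixture_representationE sw'.
  exact: linearly_independent_positive_sum indep sw sw'.
move=> [w0 [_ w0_uniq]].
apply: (positive_sum_unique_linearly_independent (w0 := w0)) => // w sw.
by apply/esym/w0_uniq/mixture_representationE.
Qed.

Hypothesis a_cont : forall i, continuous (a i).
Hypothesis a_int : forall x sigma i, Sigma sigma ->
  (`| \int[delta x sigma]_y (a i y)%:E | < +oo)%E.

(** This identifies functionals on moment vectors with integrals of elements of [lin a]. *)
Lemma integral_lin_moment_vector (c : 'I_m -> R) x sigma : Sigma sigma ->
  (\int[delta x sigma]_y (\sum_(i < m) c i * a i y)%:E =
   (\sum_(i < m) c i * t (x, sigma) 0 i)%:E)%E.
Proof.
move=> Ssigma.
have a_integrable i : (delta x sigma).-integrable setT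
    (fun y : borel X => (a i y)%:E).
  apply: integrable_abs_integral_lty; last exact: a_int.
  by apply/measurable_EFinP; exact: continuous_borel_measurable.
under eq_integral do rewrite -sumEFin.
rewrite integral_sum//; last first.
  by move=> i; under eq_fun do rewrite EFinM; exact: integrableZl.
rewrite -sumEFin; apply: eq_bigr => i _.
under eq_integral do rewrite EFinM.
rewrite integralZl// EFinM /t /moment_vector mxE /Rintegral fineK//.
exact: integrable_fin_num.
Qed.

Variable sigma0 : P.
Hypothesis a_lim : forall x i,
  has_limit_in Sigma sigma0 (fun sigma => \int[delta x sigma]_y a i y) (a i x).

Lemma lin_ge0 (c : 'I_m -> R) :
  (forall q, D q -> 0 <= \sum_(i < m) c i * t q 0 i) ->
  forall x, 0 <= \sum_(i < m) c i * a i x.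
Proof.
(* The limit hypothesis yields a limit point only through some index [i]; for [m = 0] the sum is
   empty. *)
move=> ct0 x; have [[i _]|m0] := pselect (exists i : 'I_m, True); last first.
  by rewrite big1// => i; case: m0; exists i.
have [lim0 _] := a_lim x i.
apply: (@has_limit_in_ge0 _ _ Sigma sigma0
  (fun sigma => \sum_(i < m) c i * t (x, sigma) 0 i)); last first.
  by move=> sigma Ssigma; apply: ct0.
split => //; have Fs : Filter (within Sigma sigma0^') by exact: within_filter.
apply: cvg_big => [|j _].
  exact: (@pseudometric_normed_Zmodule.add_continuous _ R^o).
apply: cvgMl_tmp; rewrite /t/=; under eq_fun do rewrite mxE.
by have [] := a_lim x j.
Qed.

Hypothesis a_indep : linearly_independent [set: 'I_m] (a : 'I_m -> (X -> R^o)).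

Lemma lin_eq0 (c : 'I_m -> R) :
  (forall x, \sum_(i < m) c i * a i x = 0) -> forall i, c i = 0.
Proof.
move=> ca0; apply: (a_indep (p := id)) => //.
apply/funext => x; rewrite fct_sumE; exact: ca0.
Qed.

(** If a functional vanishes on all moment vectors, [lin_ge0] applies to it and to its negative, so
    the combination of the [a i] is zero and so are its coefficients. *)
Lemma moment_basis :
  exists2 B : 'M[R]_m, B \in unitmx &
    exists2 p : 'I_m -> I, forall i, D (p i) & forall i, row i B = t (p i).
Proof.
have [|B Bunit tB] := @spanning_basis R m [set t q | q in D].
  move=> c ct0; apply: lin_eq0 => x; apply/eqP; rewrite eq_le; apply/andP; split.
    rewrite -oppr_ge0 -sumrN; under eq_bigr do rewrite -mulNr.
    apply: (lin_ge0 (c := fun i => - c i)) => q Dq.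
    under eq_bigr do rewrite mulNr.
    by rewrite sumrN ct0 ?oppr0//; exists q.
  by apply: lin_ge0 => q Dq; rewrite ct0//; exists q.
exists B => //; have /choice[p hp] i : exists q, D q /\ row i B = t q.
  by have [q Dq <-] := tB i; exists q.
by exists p => i; have [] := hp i.
Qed.

Lemma interior_moment_coneP s : D !=set0 -> moment_cone a delta Sigma s ->
  (moment_cone a delta Sigma)° s <->
  atoms a delta Sigma s = [set: X] `*` Sigma.
Proof.
rewrite moment_coneE atomsE => D0 sm; split=> [s_int|satoms].
  apply/seteqP; split => q; first by move=> [Dq _]; split.
  move=> [_ Dq]; apply/(atomP _ _ _ D0); split => //.
  have [c c0 Tc] := interior_sub_scale (t q) s_int.
  by exists c => //; exists (s - c *: t q) => //; rewrite addrC subrK.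
have [B Bunit [p Dp Bp]] := moment_basis.
have ps i : atom t D s (p i).
  by rewrite -[atom _ _ _]/(atom t D s : set (X * P)) satoms; split => //; exact: Dp.
have [e e0 [r rm ->]] := atoms_decomposition D0 sm ps.
under eq_bigr do rewrite -Bp.
apply: cone_interior => //; first exact: conic_sum_cone.
by move=> i; rewrite Bp; exact: conic_sum_gen.
Qed.

Lemma moment_cone_interior s :
  (forall x sigma, Sigma sigma -> (measure_support (delta x sigma))° !=set0) ->
  (forall f : X -> R, lin a f -> (forall x, 0 <= f x) ->
     forall U : set X, U° !=set0 -> (forall x, U x -> f x = 0) ->
     forall x, f x = 0) ->
  D !=set0 -> moment_cone a delta Sigma s -> s <> 0 ->
  (moment_cone a delta Sigma)° s.
Proof.
rewrite moment_coneE => supp_int vanish D0 sm s0; apply: contrapT => s_bd.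
have [B Bunit [p Dp Bp]] := moment_basis.
have TB i : conic_sum t D m (row i B) by rewrite Bp; exact: conic_sum_gen.
have [c [i ci] [cT cs]] :=
  supporting_functional (conic_sum_cone t D0) Bunit TB sm s_bd.
have ct0 q : D q -> 0 <= \sum_(i < m) c i * t q 0 i.
  by move=> Dq; apply: cT; exact: conic_sum_gen.
have [w [k [d [q [d0 Dq _ sE]]]]] := positive_sum_exists sm.
(* The value at [s] is a sum of nonnegative terms and at most zero, so each term vanishes. *)
have {}cs : \sum_(j < k) d j * (\sum_(i < m) c i * t (q j) 0 i) = 0.
  apply/eqP; rewrite eq_le sumr_ge0 ?andbT; last first.
    by move=> j _; rewrite mulr_ge0 ?ct0// ltW.
  apply: (le_trans _ cs); rewrite le_eqVlt; apply/orP; left; apply/eqP.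
  under eq_bigr do rewrite mulr_sumr.
  rewrite exchange_big; apply: eq_bigr => l _ /=.
  rewrite sE summxE mulr_sumr; apply: eq_bigr => j _.
  by rewrite [in RHS]mxE mulrCA.
have [j _] : exists j : 'I_k, True.
  apply: contrapT => k0; apply: s0; rewrite sE big1// => j.
  by case: k0; exists j.
have cqj : \sum_(i < m) c i * t (q j) 0 i = 0.
  move/eqP: cs; rewrite psumr_eq0; last first.
    by move=> l _; rewrite mulr_ge0 ?ct0// ltW.
  move=> /allP/(_ j (mem_index_enum j))/=.
  by rewrite mulf_eq0 gt_eqF//= => /eqP.
pose f x := \sum_(i < m) c i * a i x.
have f0 x : 0 <= f x by exact: lin_ge0.
have f_cont : continuous f.
  move=> x; apply: cvg_big => [|l _].
    exact: (@pseudometric_normed_Zmodule.add_continuous _ R^o).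
  by apply: cvgMl_tmp; exact: a_cont.
have fsupp x : measure_support (delta (q j).1 (q j).2) x -> f x = 0.
  apply: continuous_integral0_support => //.
  rewrite integral_lin_moment_vector; last exact: Dq.
  by rewrite -surjective_pairing cqj.
apply/negP: ci; rewrite negbK; apply/eqP; apply: lin_eq0.
apply: (vanish f _ f0 _ (supp_int _ _ (Dq j)) fsupp).
by exists c.
Qed.

Lemma full_atoms_dependent : limit_point Sigma sigma0 ->
  ~ linearly_independent ([set: X] `*` Sigma) t.
Proof.
move=> /(limit_point_infinite_set (hausdorff_accessible (@metric_hausdorff _ P))).
(* Infinitely many parameters over the single base point [point] already give too many vectors. *)
move=> /infiniteP/card_leP[g].
pose f (n : nat) : P := val (g (to_setT n)).
apply: (@infinite_atoms_dependent _ _ _ _ _ (fun n => (point, f n))).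
  move=> k l [] /val_inj /(@inj _ _ _ g) kl.
  by have /(congr1 val) := kl (in_setT _) (in_setT _).
by move=> n; split => //; exact: set_mem (valP (g (to_setT n))).
Qed.

End MomentCone.

Theorem theorem25 (R : realType) (X : ptopologicalType) (P : metricType R)
  (Sigma : set P) (sigma0 : P)
  (delta : X -> P -> probability (borel X) R)
  (m : nat) (a : 'I_m -> X -> R)
  (a_cont : forall i, continuous (a i))
  (a_indep : linearly_independent [set: 'I_m] (a : 'I_m -> (X -> R^o)))
  (a_int : forall x sigma i, Sigma sigma ->
     (`| \int[delta x sigma]_y (a i y)%:E | < +oo)%E)
  (sigma0_cl : closure Sigma sigma0)
  (a_lim : forall x i,
     has_limit_in Sigma sigma0
       (fun sigma => \int[delta x sigma]_y a i y) (a i x)) :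
  (forall s, moment_cone a delta Sigma s ->
     ((moment_cone a delta Sigma)° s <->
      atoms a delta Sigma s = [set: X] `*` Sigma))
  /\
  (forall s, moment_cone a delta Sigma s ->
     (indeterminate a delta Sigma s <->
      ~ linearly_independent (atoms a delta Sigma s)
          (fun q => moment_vector a delta q.1 q.2)))
  /\
  (hausdorff_space X -> locally_compact [set: X] ->
   (forall x sigma, Sigma sigma ->
      exists U : set X, [/\ compact U, U° !=set0,
        U `<=` measure_support (delta x sigma) &
        (0 < delta x sigma U)%E]) ->
   (forall f : X -> R, lin a f -> (forall x, 0 <= f x) ->
      forall U : set X, U° !=set0 -> (forall x, U x -> f x = 0) ->
      forall x, f x = 0) ->
   forall s, moment_cone a delta Sigma s -> s <> 0 ->
     indeterminate a delta Sigma s /\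
     atoms a delta Sigma s = [set: X] `*` Sigma).

Proof.
have [sigma [Ssigma _]] := sigma0_cl setT filterT.
have D0 : [set q : X * P | Sigma q.2] !=set0 by exists (point, sigma).
split; [|split].
- by move=> s; exact: (interior_moment_coneP a_lim a_indep D0).
- by move=> s; exact: indeterminateP.
- move=> _ _ supp vanish s sT s0.
  have s_int : (moment_cone a delta Sigma)° s.
    apply: moment_cone_interior => // x sigma' /(supp x)[U [_ [y Uy] Usupp _]].
    by exists y; exact: filterS Usupp Uy.
  have satoms : atoms a delta Sigma s = [set: X] `*` Sigma.
    exact/(interior_moment_coneP a_lim a_indep D0 sT).
  split => //; apply/(indeterminateP D0 sT); rewrite satoms.
  apply: (@full_atoms_dependent _ _ _ _ _ _ _ sigma0).
  (* Since [s] is nonzero, [m] is positive, and any index gives that [sigma0] is a limit point of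
     [Sigma]. *)
  have [i _] : exists i : 'I_m, True.
    apply: contrapT => m0; apply: s0; apply/rowP => i.
    by case: m0; exists i.
  by have [] := a_lim point i.
Qed.
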